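(* Let $X$ be a compact metrizable space and let $\mathcal I$ be a $\sigma^{( * )}$-ideal on $X$. Then $\mathcal I$ (ordered by inclusion) is Tukey reducible to the ideal $\mathrm{NWD}$ of nowhere dense subsets of the Cantor cube $2^\omega$ (ordered by inclusion), and, assuming $X=\bigcup\mathcal I\notin\mathcal I$ (so that the cardinal characteristics of $\mathcal I$ are defined), $\mathrm{add}(\mathcal I)\ge\mathrm{add}(\mathcal M)$ and $\mathrm{cof}(\mathcal I)\le\mathrm{cof}(\mathcal M)$, where $\mathcal M$ is the ideal of meager subsets of the Hilbert cube $[0,1]^\omega$.
   Context: An ideal on a set is a non-empty family of subsets closed under subsets and finite unions. For a compact space $X$, $\mathcal K(X)$ is the family of all compact subsets of $X$ with the Vietoris topology; for $G\subseteq X$, $\mathcal K(G)$ is the family of compact subsets of $G$. An ideal $\mathcal I$ on $X$ is a $G_\delta$-ideal if $\mathcal I\cap\mathcal K(X)$ is a $G_\delta$-set in $\mathcal K(X)$. It has the Solecki property $( * )$ if for any countable family $\mathcal A\subseteq\mathcal I\cap\mathcal K(X)$ the union $\bigcup\mathcal A$ is contained in a $G_\delta$-subset $G\subseteq X$ with $\mathcal K(G)\subseteq\mathcal I$. It is a $\sigma^{( * )}$-ideal if there is a sequence $(\mathcal I_n)_{n\in\omega}$ of $G_\delta$-ideals with the Solecki property $( * )$ on $X$ such that $\mathcal I=\{A\subseteq X: A\subseteq\bigcup\mathcal A$ for some countable subfamily $\mathcal A\subseteq\bigcup_{n\in\omega}(\mathcal I_n\cap\mathcal K(X))\}$. A partially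 ordered set $A$ is Tukey reducible to a partially ordered set $B$ if there is a function $f:A\to B$ such that for each $b\in B$ the set $\{a\in A:f(a)\le b\}$ is upper bounded in $A$. For an ideal $\mathcal I$ on a set $X=\bigcup\mathcal I\notin\mathcal I$: $\mathrm{add}(\mathcal I)=\min\{|\mathcal A|:\mathcal A\subseteq\mathcal I,\ \bigcup\mathcal A\notin\mathcal I\}$, $\mathrm{cof}(\mathcal I)=\min\{|\mathcal A|:\mathcal A\subseteq\mathcal I,\ \forall B\in\mathcal I\ \exists A\in\mathcal A\ (B\subseteq A)\}$. *)

(* Defs.v *)
From HB Require Import structures.
From mathcomp Require Import all_boot all_order all_algebra.
From mathcomp Require Import all_classical all_reals all_analysis.
From mathcomp Require Import borel_hierarchy.

Set Implicit Arguments.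
Unset Strict Implicit.
Unset Printing Implicit Defensive.

Import Order.TTheory GRing.Theory Num.Theory.
Import numFieldTopology.Exports.

Local Open Scope classical_set_scope.
Local Open Scope ring_scope.
Local Open Scope card_scope.

(* Nonnegativity of d follows from the first three clauses. *)
Definition metrizable (R : realType) (X : topologicalType) : Prop :=
  exists d : X -> X -> R,
    [/\ forall x y, d x y = 0 <-> x = y,
        forall x y, d x y = d y x,
        forall x y z, d x z <= d x y + d y z
      & forall x, nbhs x =
          filter_from [set e : R | 0 < e] (fun e => [set y | d x y < e])].

(* K(X): all compact subsets of X, including the empty one. *)
Definition hyperspace (X : topologicalType) : Type :=
  set_type [set K : set X | compact K].

HB.instance Definition _ (X : topologicalType) := Choice.on (hyperspace X).

Definition vietoris_subbase (X : topologicalType) : set (set (hyperspace X)) :=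
  [set S | exists2 U : set X, open U &
    S = [set K | set_val K `<=` U] \/ S = [set K | set_val K `&` U !=set0]].

HB.instance Definition _ (X : topologicalType) :=
  @isSubBaseTopological.Build (hyperspace X)
    (set (hyperspace X)) (@vietoris_subbase X) id.

Record is_ideal (T : Type) (I : set (set T)) : Prop := IsIdeal {
  ideal_nonempty : I !=set0 ;
  ideal_sub : forall A B, A `<=` B -> I B -> I A ;
  ideal_setU : forall A B, I A -> I B -> I (A `|` B) }.

Section sigma_star_ideals.
Variable X : topologicalType.
Implicit Type I : set (set X).

Definition Gdelta_ideal I : Prop :=
  is_ideal I /\ Gdelta [set K : hyperspace X | I (set_val K)].

Definition solecki_property I : Prop :=
  forall F : set (set X), countable F -> F `<=` I `&` compact ->
  exists G : set X, [/\ Gdelta G, \bigcup_(A in F) A `<=` G &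
    forall K, compact K -> K `<=` G -> I K].

Definition sigma_star_ideal I : Prop :=
  is_ideal I /\
  exists J : (set (set X))^nat,
    (forall n, Gdelta_ideal (J n) /\ solecki_property (J n)) /\
    I = [set A | exists F : set (set X), [/\ countable F,
      F `<=` \bigcup_n (J n `&` compact) & A `<=` \bigcup_(B in F) B]].

End sigma_star_ideals.

(* An ideal I : set (set T), seen as a type, is ordered by inclusion, the order
   it inherits from set T. *)
HB.instance Definition _ (T : Type) (A : set T) :=
  SubType.copy (set_type A) {x : T | x \in A}.
HB.instance Definition _ d (T : porderType d) (A : set T) :=
  [SubChoice_isSubPOrder of set_type A by <: with d].

Definition tukey_reducible dA dB (A : porderType dA) (B : porderType dB)
    : Prop :=
  exists f : A -> B, forall b : B,
  exists u : A, forall a : A, (f a <= b)%O -> (a <= u)%O.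

Definition nowhere_dense (T : topologicalType) : set (set T) :=
  [set A | interior (closure A) = set0].
Arguments nowhere_dense : clear implicits.

Definition meager (T : topologicalType) : set (set T) :=
  [set A | exists2 F : (set T)^nat,
    (forall n, nowhere_dense T (F n)) & A `<=` \bigcup_n F n].
Arguments meager : clear implicits.

Definition hilbert_cube (R : realType) : topologicalType :=
  prod_topology (fun _ : nat => set_type (`[0, 1]%classic : set R)).

Section cardinal_characteristics.
Variable T : Type.
Implicit Types (I : set (set T)) (F : set (set T)).

(* Cardinals are represented by sets of that cardinality:
   F has the least cardinality among the families satisfying P. *)
Definition realizes_min_card (P : set (set (set T))) F : Prop :=
  P F /\ forall F', P F' -> F #<= F'.

Definition realizes_add I F : Prop :=
  realizes_min_card
    [set F | F `<=` I /\ ~ I (\bigcup_(A in F) A)] F.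

Definition realizes_cof I F : Prop :=
  realizes_min_card
    [set F | F `<=` I /\ forall B, I B -> exists2 A, F A & B `<=` A] F.

End cardinal_characteristics.

(* Main.v *)
(* Let J be a Gdelta-ideal with property ( * ). Given a closed upward family F of
   compact sets missing J, property ( * ) and a Baire category argument give a
   portion of F such that any countably many compact members of J lie in an open
   set containing no member of the portion. The basic open sets for which this
   remains true are stable under absorbing a compact member of J. Exhausting the
   complement of J by countably many portions yields sequences [t i] of open sets
   such that each [t i p] together with a compact K in J lies in some [t i q],
   while a compact L outside J is, for some i, not covered by the closure of any
   [t i p]. So, sending a member A of the sigma-ideal, covered by compact sets
   K_l, to the set of those (l, i, p) with K_l inside [t i p], we get a Tukey map
   into the dense open subsets of a countable poset Q under reverse inclusion.

   A point z of the Cantor or Hilbert cube is read as a sequence of finite partial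
   functions from Q to Q. A dense open D is sent to the closed nowhere dense set of
   those z none of whose terms maps into D everything reached by the terms
   before it. If this set lies inside a nowhere dense N, then for each p in Q a
   word avoiding N must contain a term good for D, and applying all its terms
   to p in turn leads into D; the endpoints thus generate a dense open subset of D
   which depends on N only. For a union of countably many nowhere dense sets, one
   runs this along all nodes of a tree, and a Baire argument shows that some node
   works. *)
Require Import Defs.
From HB Require Import structures.
From mathcomp Require Import all_boot all_order all_algebra.
From mathcomp Require Import all_classical all_reals all_analysis.
From mathcomp Require Import zify lra.

Set Implicit Arguments.
Unset Strict Implicit.
Unset Printing Implicit Defensive.

Local Open Scope classical_set_scope.
Local Open Scope card_scope.

(** * Compactness and bases of metrizable spaces *)

(** If [Q K] fails, the sets whose complement in [K] satisfies [Q] form a proper filter, and a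
    cluster point of it in [K] has no neighbourhood satisfying [Q]. *)
Lemma compact_ind (X : topologicalType) (K : set X) (Q : set X -> Prop) :
  compact K -> Q set0 -> (forall A B, A `<=` B -> Q B -> Q A) ->
  (forall A B, Q A -> Q B -> Q (A `|` B)) ->
  (forall x, K x -> exists2 U, nbhs x U & Q U) -> Q K.
Proof.
move=> Kco Q0 Qsub QU Qloc; apply: contrapT => nQK.
pose F := [set A | Q (K `\` A)].
have FF : ProperFilter F.
  split; first by rewrite /F /= setD0.
  split.
  - by rewrite /F /= setDT.
  - move=> A B QA QB; apply: (Qsub _ _ _ (QU _ _ QA QB)).
    by rewrite -setDIr.
  - rewrite /F /=; by move=> A B AB; apply: Qsub => x [Kx nBx]; split=> // /AB.
have FK : F K by rewrite /F /= setDv.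
have [x [Kx clx]] := Kco F FF FK.
have [U Ux QU'] := Qloc x Kx.
have FU : F (~` U) by rewrite /F /=; apply: Qsub QU' => y [_ /contrapT].
by have [y [nUy Uy]] := clx _ _ FU Ux.
Qed.

Definition regular_base (X : topologicalType) (b : nat -> set X) : Prop :=
  (forall m, open (b m)) /\
  forall K O, compact K -> open O -> K `<=` O ->
    exists m, K `<=` b m /\ closure (b m) `<=` O.

Section metric_space.
Local Open Scope ring_scope.
Import Order.TTheory GRing.Theory Num.Theory.

Lemma metrizable_hausdorff (R : realType) (X : topologicalType) :
  metrizable R X -> hausdorff_space X.
Proof.
move=> [d [d0 dC dT dn]] p q cl; apply: contrapT => pq.
have dpq : 0 < d p q.
  have : d p q != 0 by apply/eqP => /d0.
  have := dT p q p; rewrite (dC q p) (d0 p p).2 //.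
  by move: (d p q) => r; lra.
have B x : nbhs x [set y | d x y < d p q / 2].
  by rewrite dn; exists (d p q / 2) => //=; lra.
have [z /= [pz qz]] := cl _ _ (B p) (B q).
by have := dT p z q; rewrite (dC z q); lra.
Qed.

(** For each n, finitely many balls of radius 1/(n+1) cover the space; the base consists of the
    finite unions of all these balls, indexed by codes of lists of pairs. *)
Lemma metrizable_regular_base (R : realType) (X : topologicalType) :
  metrizable R X -> compact [set: X] ->
  exists b : nat -> set X, regular_base b.
Proof.
move=> [d [d0 dC dT dn]] Xco.
pose B x (n : nat) := [set y | d x y < n.+1%:R^-1].
have nB x n : nbhs x (B x n).
  by rewrite dn; exists (n.+1%:R^-1) => //=.
have oB x n : open (B x n).
  rewrite openE => y /= Bxy; rewrite /interior dn.
  exists (n.+1%:R^-1 - d x y) => /=; first by rewrite subr_gt0.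
  by move=> z /= yz; rewrite /B /=; have := dT x y z; move: (_^-1) yz => r; lra.
have clB x n : closure (B x n) `<=` [set y | d x y <= n.+1%:R^-1].
  move=> y /(_ [set z | d y z < d x y - n.+1%:R^-1]) cly /=.
  rewrite leNgt; apply/negP => lt.
  have [|z [/= Bz yz]] := cly.
    by rewrite dn; exists (d x y - n.+1%:R^-1) => //=; rewrite subr_gt0.
  move: Bz; rewrite /B /=; have := dT x z y; rewrite (dC z y).
  by move: (_^-1) lt yz => r; lra.
have cov n : exists s : seq (set X),
    (forall x, exists2 A, A \in s & A x) /\ {in s, forall A, exists x, A = B x n}.
  have : exists s : seq (set X),
    (forall x, [set: X] x -> exists2 A, A \in s & A x)
    /\ {in s, forall A, exists x, A = B x n}.
    apply: (@compact_ind X setT (fun T => exists s : seq (set X),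
      (forall x, T x -> exists2 A, A \in s & A x)
      /\ {in s, forall A, exists x, A = B x n})) => //.
    - by exists [::]; split.
    - by move=> S T ST [s [h1 h2]]; exists s; split=> // x /ST; exact: h1.
    - move=> S T [s [h1 h2]] [t [h3 h4]]; exists (s ++ t); split.
        by move=> x [/h1|/h3] [A As Ax]; exists A => //; rewrite mem_cat As ?orbT.
      by move=> A; rewrite mem_cat => /orP[/h2|/h4].
    - move=> x _; exists (B x n) => //; exists [:: B x n]; split.
        by move=> y By; exists (B x n); rewrite ?mem_head.
      by move=> A; rewrite inE => /eqP ->; exists x.
  by move=> [s [h1 h2]]; exists s; split=> // x; exact: h1.
have [S Scov] := choice cov.
pose c (i : nat * nat) := nth set0 (S i.1) i.2.
have oc i : open (c i).
  rewrite /c; have [lt|ge] := ltnP i.2 (size (S i.1)); last by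
    rewrite nth_default //; exact: open0.
  by have [x ->] := (Scov i.1).2 _ (mem_nth set0 lt).
pose u (s : seq (nat * nat)) := \big[setU/set0]_(i <- s) c i.
have ou s : open (u s).
  rewrite /u; elim: s => [|i s IH]; first by rewrite big_nil; exact: open0.
  by rewrite big_cons; exact: openU.
exists (fun m => u (odflt [::] (unpickle m))); split=> // K O Kco oO KO.
suff [s [Ks sO]] : exists s, K `<=` u s /\ closure (u s) `<=` O.
  by exists (pickle s); rewrite pickleK.
apply: (@compact_ind X K (fun T => exists s, T `<=` u s /\ closure (u s) `<=` O)) => //.
- by exists [::]; rewrite /u !big_nil; split=> //; rewrite closure0.
- by move=> A C AC [s [Cs sO]]; exists s; split=> //; exact: subset_trans Cs.
- move=> A C [s [As sO]] [t [Ct tO]]; exists (s ++ t).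
  rewrite /u big_cat closureU; split; first exact: setUSS.
  by move=> x [/sO|/tO].
- move=> x /KO Ox; have := open_nbhs_nbhs (conj oO Ox).
  rewrite {1}dn => -[e /= e0 eO].
  (* A closed ball of radius below e/2 that contains [x] stays within distance [e] of [x]. *)
  have [n ne] : exists n : nat, n.+1%:R^-1 < e / 2.
    have e20 : 0 < e / 2 by lra.
    have [n _ ne] := near_infty_natSinv_lt (PosNum e20).
    by exists n; apply: (ne n) => /=.
  have [A As Ax] := (Scov n).1 x.
  have [y Ay] := (Scov n).2 A As.
  have cA : c (n, index A (S n)) = A by rewrite /c /= nth_index.
  have uA : u [:: (n, index A (S n))] = A by rewrite /u big_seq1 cA.
  exists (B y n); first by apply: open_nbhs_nbhs; split; [exact: oB | rewrite -Ay].
  exists [:: (n, index A (S n))]; rewrite uA Ay; split=> // z.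
  move: Ax; rewrite Ay /B /= => dyx /clB /= dyz; apply: eO => /=.
  by have := dT x y z; rewrite (dC x y); move: (_^-1) ne dyx dyz => r; lra.
Qed.

End metric_space.

(** * Neighbourhoods in the Vietoris topology *)

(* Otherwise sets outside U inside ever smaller neighbourhoods of K would have, along
   an ultrafilter, a Vietoris limit C inside K. *)
Lemma vietoris_upper (X : topologicalType) (J : set (set X))
    (U : set (hyperspace X)) (K : set X) :
  hausdorff_space X -> compact [set: X] -> open U ->
  (forall A B, A `<=` B -> J B -> J A) ->
  (forall L : hyperspace X, J (set_val L) -> U L) ->
  compact K -> J K ->
  exists W, [/\ open W, K `<=` W &
    forall L : hyperspace X, set_val L `<=` W -> U L].
Proof.
move=> hX Xco oU Jsub JU Kco JK; apply: contrapT => noW.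
have {}noW W : open W -> K `<=` W ->
    exists L : hyperspace X, set_val L `<=` W /\ ~ U L.
  move=> oW KW; apply: contrapT => noL; apply: noW; exists W; split=> // L LW.
  by apply: contrapT => nUL; apply: noL; exists L.
pose F := filter_from [set W | open W /\ K `<=` W]
  (fun W => [set L : hyperspace X | set_val L `<=` W /\ ~ U L]).
have FF : ProperFilter F.
  apply: filter_from_proper; last by move=> W [oW KW]; exact: noW.
  apply: filter_from_filter; first by exists setT; split=> //; exact: openT.
  move=> W V [oW KW] [oV KV]; exists (W `&` V).
    by split; [exact: openI | rewrite subsetI].
  by move=> L /= [+ nU]; rewrite subsetI => -[LW LV].
have [G [GU FG]] := ultraFilterLemma FF.
(* [C] consists of the points each of whose open neighbourhoods meets [G]-almost every set. *)
pose C := [set x | forall O, open O -> O x ->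
   G [set L : hyperspace X | set_val L `&` O !=set0]].
have GnU : G (~` U).
  apply: FG; exists setT; last by move=> L [].
  by split=> //; exact: openT.
have GC A : ~ G A -> G (~` A).
  by have [] := in_ultra_setVsetC A GU => // GA; case.
have CK : C `<=` K.
  move=> x Cx; apply: contrapT => nKx.
  have clK := compact_closed hX Kco.
  have nx : K `<=` ~` [set x] by move=> y Ky /= yx; apply: nKx; rewrite -yx.
  have ox : open (~` [set x]).
    apply: closed_openC; apply: compact_closed => //; exact: compact_set1.
  have := @compact_normal X hX Xco K clK (~` [set x]).
  have sn : set_nbhs K (~` [set x]).
    by apply/set_nbhsP; exists (~` [set x]); split.
  move=> /(_ sn) [V /set_nbhsP [W [oW KW WV]] clV].
  have GW : G [set L : hyperspace X | set_val L `<=` W].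
    by apply: FG; exists W => // L [].
  have nV : (~` closure V) x by move=> /clV /(_ erefl).
  have oV : open (~` closure V) by apply: closed_openC; exact: closed_closure.
  have [L [LW [y [Ly nVy]]]] := filter_ex (filterI GW (Cx _ oV nV)).
  exact: (nVy (subset_closure (WV _ (LW _ Ly)))).
have clC : closed C.
  rewrite -openC openE; move=> x /= /existsNP [ O /not_implyP [oO /not_implyP [Ox nG]]].
  apply: filterS (open_nbhs_nbhs (conj oO Ox)) => y Oy Cy.
  by apply: nG; exact: Cy.
have Cco : compact C by exact: (subclosed_compact clC Xco).
pose CC : hyperspace X := SigSub (mem_set Cco : C \in [set K : set X | compact K]).
have UC : U CC by apply: JU; apply: Jsub JK.
suff GUU : G U by have [L [/= nU /nU]] := filter_ex (filterI GnU GUU).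
have Gsub (E : set (hyperspace X)) : vietoris_subbase E -> E CC -> G E.
  move=> [ O oO [->|->]] /=; last first.
    by move=> [x [Cx Ox]]; exact: Cx.
  move=> CO.
  have nOco : compact (~` O).
    by apply: (subclosed_compact _ Xco) => //; exact: open_closedC.
  (* Each point outside [O] is outside [C], so it has a neighbourhood missed by [G]-almost every
     set; finitely many of these cover the complement of [O]. *)
  have : G [set L : hyperspace X | set_val L `&` (~` O) = set0].
    apply: (@compact_ind X (~` O)
      (fun T => G [set L : hyperspace X | set_val L `&` T = set0])) => //.
    - by apply: filterS filterT => L _ /=; rewrite setI0.
    - move=> A B AB; apply: filterS => L /= LB.
      by apply/seteqP; split=> // x [Lx /AB Bx]; rewrite -LB.
    - move=> A B GA GB; apply: filterS (filterI GA GB) => L /= [LA LB].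
      by rewrite setIUr LA LB setU0.
    - move=> x nOx; have : ~ C x by move=> /CO.
      move=> /existsNP [V /not_implyP [oV /not_implyP [Vx /GC nG]]].
      exists V; first by apply: open_nbhs_nbhs.
      by apply: filterS nG => L /= /set0P/negP/negPn/eqP.
  apply: filterS => L /= LO x Lx; apply: contrapT => nOx.
  by have : (set_val L `&` ~` O) x by []; rewrite LO.
have : nbhs CC U by apply: open_nbhs_nbhs.
rewrite nbhsE => -[_ [[B sB <-] [D BD DC] sU]].
apply: filterS sU _; apply: (@filterS _ _ _ D); first by move=> ? ?; exists D.
have /sB [E sE IE] := BD; rewrite -IE; apply: filter_bigI => S ES.
apply: Gsub; first by have /sE := ES; rewrite inE.
by move: DC; rewrite -IE => /(_ _ ES).
Qed.

Lemma nested_closed_sub (X : topologicalType) (C : nat -> set X) (W : set X) :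
  compact [set: X] -> (forall i, closed (C i)) ->
  (forall i, C i.+1 `<=` C i) -> open W -> \bigcap_i C i `<=` W ->
  exists i, C i `<=` W.
Proof.
move=> Xco clC decC oW CW.
have dec i j : (i <= j)%N -> C j `<=` C i.
  elim: j => [|j IH]; first by rewrite leqn0 => /eqP ->.
  rewrite leq_eqVlt => /orP[/eqP -> //|/IH]; exact: subset_trans.
suff [i Ci] : exists i, ~` W `&` C i = set0.
  exists i => x Cx; apply: contrapT => nWx.
  by have : (~` W `&` C i) x by []; rewrite Ci.
have nWco : compact (~` W).
  by apply: (subclosed_compact _ Xco) => //; exact: open_closedC.
apply: (compact_ind (Q := fun T => exists i, T `&` C i = set0) nWco).
- by exists 0%N; rewrite set0I.
- move=> A B AB [i Bi]; exists i; apply/seteqP; split=> // x [/AB Bx Cx].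
  by rewrite -Bi.
- move=> A B [i Ai] [j Bj]; exists (maxn i j).
  apply/seteqP; split=> // x [[Ax|Bx] Cx].
    by rewrite -Ai; split=> //; apply: dec Cx; exact: leq_maxl.
  by rewrite -Bj; split=> //; apply: dec Cx; exact: leq_maxr.
- move=> x nWx; have /existsNP [i /not_implyP [_ nC]] : ~ (\bigcap_i C i) x.
    by move=> /CW.
  exists (~` C i); last by exists i; rewrite setICl.
  by apply: open_nbhs_nbhs; split=> //; exact: closed_openC.
Qed.

(** * Absorbing sequences from the Solecki property *)

(* The closed upward families of compact sets are those of this form, with WW a
   family of open sets. *)
Definition elusive (X : topologicalType) (WW : set (set X)) : set (set X) :=
  [set L | compact L /\ forall W, WW W -> ~ L `<=` W].

Definition absorbing (X : topologicalType) (J : set (set X))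
    (t : nat -> set X) : Prop :=
  forall K, compact K -> J K -> forall p, exists q, t p `|` K `<=` t q.

Section representation.
Variables (X : topologicalType) (b : nat -> set X) (J : set (set X)).
Hypotheses (Xco : compact [set: X]) (breg : regular_base b) (Jsol : solecki_property J).

(* Were the conclusion false for every basic open set meeting the family, the
   Gdelta set given by the Solecki property for all the witnesses would contain
   the intersection of a nested sequence of closures of basic open sets, each
   containing an elusive set; this intersection would be elusive and in J. *)
Lemma solecki_core (WW : set (set X)) :
  (forall W, WW W -> open W) ->
  (forall K, compact K -> J K -> ~ elusive WW K) -> elusive WW !=set0 ->
  exists m, (exists2 L, elusive WW L & L `<=` b m) /\
    forall KK : set (set X), countable KK -> KK `<=` J `&` compact ->
    exists G, [/\ open G, \bigcup_(K in KK) K `<=` G &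
      forall L, elusive WW L -> ~ L `<=` G `&` b m].
Proof.
move=> WWo WWJ [L0 eL0]; apply: contrapT => noCore.
pose P m := exists2 L, elusive WW L & L `<=` b m.
have bad m : exists KK : set (set X), [/\ countable KK, KK `<=` J `&` compact &
    P m -> forall G, open G -> \bigcup_(K in KK) K `<=` G ->
    exists2 L, elusive WW L & L `<=` G `&` b m].
  have [Pm|nPm] := pselect (P m); last first.
    by exists set0; split=> //; exact: countable0.
  apply: contrapT => noKK; apply: noCore; exists m; split=> // KK cKK KKJ.
  apply: contrapT => noG; apply: noKK; exists KK; split=> // _ G oG KG.
  apply: contrapT => noL; apply: noG; exists G; split=> // L eL LG.
  by apply: noL; exists L.
have [KK KKP] := choice bad.
have [|A [m _ KA]|G [[H oH GH] KG GJ]] := Jsol (F := \bigcup_m KK m).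
- by apply: bigcup_countable => // m _; have [] := KKP m.
- by have [_ + _] := KKP m; apply.
have KKH m i : \bigcup_(K in KK m) K `<=` H i.
  move=> x [K KK' Kx]; have : G x by apply: KG; exists K => //; exists m.
  by rewrite GH; apply.
have step (im : nat * nat) : exists m', P im.2 ->
    P m' /\ closure (b m') `<=` H im.1 `&` b im.2.
  have [Pm|] := pselect (P im.2); last by exists 0%N.
  have [_ _ /(_ Pm (H im.1) (oH _) (KKH _ _)) [L eL Lb]] := KKP im.2.
  have oHb : open (H im.1 `&` b im.2) by apply: openI; [exact: oH|exact: breg.1].
  have [m' [Lm' m'b]] := breg.2 L _ eL.1 oHb Lb.
  by exists m' => _; split=> //; exists L.
have [g gP] := choice step.
have [m0 [Lm0 _]] := breg.2 L0 setT eL0.1 openT (@subsetT _ _).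
pose f := fix f n := if n is i.+1 then g (i, f i) else m0.
have Pf i : P (f i).
  by elim: i => [|i /(gP (i, f i)) []//]; exists L0.
have clf i : closure (b (f i.+1)) `<=` H i `&` b (f i).
  by have [] := gP (i, f i) (Pf i).
pose C i := closure (b (f i.+1)).
have clC i : closed (C i) by exact: closed_closure.
have decC i : C i.+1 `<=` C i.
  by move=> x /clf [_ bx]; exact: subset_closure.
pose Z := \bigcap_i C i.
have Zco : compact Z.
  apply: (subclosed_compact _ Xco) => //.
  by apply: closed_bigI => i _; exact: clC.
have JZ : J Z.
  by apply: GJ => // x Zx; rewrite GH => i _; have /clf [] := Zx i I.
have [W WWW ZW] : exists2 W, WW W & Z `<=` W.
  apply: contrapT => noW; apply: (WWJ Z) => //; split=> // W WWW ZW.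
  by apply: noW; exists W.
have [i CW] := nested_closed_sub Xco clC decC (WWo W WWW) ZW.
have [L eL Lb] := Pf i.+1.
by apply: (eL.2 W WWW) => x /Lb bx; apply: CW; exact: subset_closure.
Qed.

(** The sequence lists the basic sets with property [T] below. For such a set [V], the empty family
    [KK] already gives an open set around [closure V] with no elusive subset inside [b m], whence
    the last clause. *)
Lemma absorbing_sequence (WW : set (set X)) :
  (forall W, WW W -> open W) ->
  (forall K, compact K -> J K -> ~ elusive WW K) -> elusive WW !=set0 ->
  exists m t, [/\ exists2 L, elusive WW L & L `<=` b m, absorbing J t &
    forall L p, elusive WW L -> L `<=` b m -> ~ L `<=` closure (t p)].
Proof.
move=> WWo WWJ WW0; have [m [Lm core]] := solecki_core WWo WWJ WW0.
pose T V := forall KK : set (set X), countable KK -> KK `<=` J `&` compact ->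
  exists G, [/\ open G, \bigcup_(K in KK) K `<=` G, closure V `<=` G &
      forall L, elusive WW L -> ~ L `<=` G `&` b m].
have [n0 [_ bn0]] := breg.2 set0 set0 (@compact0 _) open0 (@subset_refl _ _).
have Tn0 : T (b n0).
  move=> KK cKK KKJ; have [G [oG KG noL]] := core KK cKK KKJ.
  by exists G; split=> // x /bn0.
have Tabs n K : T (b n) -> compact K -> J K ->
    exists n', T (b n') /\ b n `|` K `<=` b n'.
  move=> Tn Kco JK; apply: contrapT => noV.
  have bad n' : exists KK : set (set X), [/\ countable KK,
      KK `<=` J `&` compact & b n `|` K `<=` b n' ->
      forall G, open G -> \bigcup_(K in KK) K `<=` G -> closure (b n') `<=` G ->
      exists2 L, elusive WW L & L `<=` G `&` b m].
    have [bn|nbn] := pselect (b n `|` K `<=` b n'); last first.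
      by exists set0; split=> //; exact: countable0.
    apply: contrapT => noKK; apply: noV; exists n'; split=> // KK cKK KKJ.
    apply: contrapT => noG; apply: noKK; exists KK; split=> // _ G oG KG bG.
    apply: contrapT => noL; apply: noG; exists G; split=> // L eL LG.
    by apply: noL; exists L.
  have [KK KKP] := choice bad.
  (* All candidates are refuted by one countable family: [K] and the bad families of every [n']. A
     basic set between [closure (b n)] with [K] added and the resulting [G] contradicts its own bad
     family. *)
  pose KK' i := if i is n'.+1 then KK n' else [set K].
  have [||G [oG KG bG noL]] := Tn (\bigcup_i KK' i).
  - apply: bigcup_countable => // -[|n'] _; first exact: countable1.
    by have [] := KKP n'.
  - move=> A [[|n'] _ /= KKA]; first by rewrite KKA.
    by have [_ + _] := KKP n'; apply.
  have KG' : K `<=` G by move=> x Kx; apply: KG; exists K => //; exists 0%N.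
  have cobK : compact (closure (b n) `|` K).
    apply: compactU => //; apply: (subclosed_compact _ Xco) => //.
    exact: closed_closure.
  have [|n' [bn' bG']] := breg.2 _ G cobK oG; first by rewrite subUset.
  have bKn' : b n `|` K `<=` b n'.
    by apply: subset_trans bn'; apply: setSU; exact: subset_closure.
  have [_ _ /(_ bKn' G oG) KKG] := KKP n'.
  have [|//|L eL LG] := KKG; last exact: (noL L eL).
  by move=> x [K' KKK' K'x]; apply: KG; exists K' => //; exists n'.+1.
(* Indices failing [T] default to [n0], so every term of the sequence has property [T]. *)
exists m, (fun p => if `[< T (b p) >] then b p else b n0); split=> //.
- move=> K Kco JK p.
  have abs n : T (b n) -> exists q,
      b n `|` K `<=` if `[< T (b q) >] then b q else b n0.
    by move=> Tn; have [q [Tq bq]] := Tabs n K Tn Kco JK; exists q; rewrite asboolT.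
  by case: asboolP => [/abs//|_]; exact: abs.
- move=> L p eL Lb; have noT n : T (b n) -> ~ L `<=` closure (b n).
    move=> Tn Ln; have [G [_ _ nG noL]] := Tn set0 (countable0 _) (@sub0set _ _).
    by apply: (noL L eL) => x Lx; split; [apply/nG/Ln|exact: Lb].
  by case: asboolP => [/noT//|_]; exact: noT.
Qed.

Lemma absorbing_setT : absorbing J (fun _ => setT).
Proof. by move=> K _ _ p; exists 0%N. Qed.

(* The sequences obtained from a portion of the family of elusive sets are
   glued together over all portions: the part of the family not reached in
   this way is again of the form [elusive WW'], so if nonempty it would have a
   portion to which [absorbing_sequence] applies. *)
Lemma absorbing_exhaustion (WW : set (set X)) :
  (forall W, WW W -> open W) ->
  (forall K, compact K -> J K -> ~ elusive WW K) ->
  exists t : nat -> nat -> set X, (forall i, absorbing J (t i)) /\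
    forall L, elusive WW L -> exists i, forall p, ~ L `<=` closure (t i p).
Proof.
move=> WWo WWJ.
pose good m := exists t : nat -> nat -> set X, (forall i, absorbing J (t i)) /\
    forall L, elusive WW L -> L `<=` b m ->
      exists i, forall p, ~ L `<=` closure (t i p).
have tot m : exists t : nat -> nat -> set X, (forall i, absorbing J (t i)) /\
    (good m -> forall L, elusive WW L -> L `<=` b m ->
      exists i, forall p, ~ L `<=` closure (t i p)).
  have [[t [abs tL]]|ng] := pselect (good m); first by exists t.
  by exists (fun _ _ => setT); split=> // i; exact: absorbing_setT.
have [t tP] := choice tot.
pose WW' := WW `|` [set W | exists2 m, good m & W = b m].
have WW'o W : WW' W -> open W.
  by move=> [/WWo//|[m _ ->]]; exact: breg.1.
have WW'J K : compact K -> J K -> ~ elusive WW' K.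
  move=> Kco JK [_ eK]; apply: (WWJ K) => //; split=> // W WWW.
  by apply: eK; left.
pose dec i : nat * nat := odflt (0%N, 0%N) (unpickle i).
have notmet L : elusive WW L -> ~ elusive WW' L ->
    exists i, forall p, ~ L `<=` closure (t (dec i).1 (dec i).2 p).
  move=> eL neL; have [m gm Lm] : exists2 m, good m & L `<=` b m.
    apply: contrapT => noM; apply: neL; split; first exact: eL.1.
    move=> W [/eL.2//|[m gm ->] Lm]; by apply: noM; exists m.
  have [i tL] := (tP m).2 gm L eL Lm.
  by exists (pickle (m, i)); rewrite /dec pickleK.
have [e0|/set0P ne0] := eqVneq (elusive WW') set0.
  exists (fun i => t (dec i).1 (dec i).2); split=> [i|L eL].
    exact: (tP _).1.
  by apply: notmet; rewrite // e0.
exfalso; have [m [t0 [[L eL Lm] abs0 t0L]]] := absorbing_sequence WW'o WW'J ne0.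
(* The portion [b m] turns out to be good: [t0] handles its sets elusive for [WW'], the earlier
   sequences the others. So [b m] is in [WW'], yet it contains the elusive [L]. *)
apply: (eL.2 (b m)) Lm; right; exists m => //.
exists (fun i => if i is j.+1 then t (dec j).1 (dec j).2 else t0); split.
  by case=> // j; exact: (tP _).1.
move=> M eM Mm; have [eM'|neM'] := pselect (elusive WW' M).
  by exists 0%N => p; exact: t0L.
by have [i iP] := notmet M eM neM'; exists i.+1.
Qed.

End representation.

(** With [J] the trace of open sets [U n], a compact set outside some [U n] lies in no open set all
    of whose compact subsets are in [U n]. By [vietoris_upper] every compact member of [J] does lie
    in such an open set. *)
Lemma Gdelta_ideal_absorbing (X : topologicalType) (b : nat -> set X)
    (J : set (set X)) :
  hausdorff_space X -> compact [set: X] -> regular_base b ->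
  Gdelta_ideal J -> solecki_property J ->
  exists t : nat -> nat -> set X, (forall i, absorbing J (t i)) /\
    forall L, compact L -> ~ J L -> exists i, forall p, ~ L `<=` closure (t i p).
Proof.
move=> hX Xco breg [[_ Jsub _] [U oU JU]] Jsol.
pose WW n := [set W : set X | open W /\
  forall L : hyperspace X, set_val L `<=` W -> U n L].
have WWt n : exists t : nat -> nat -> set X, (forall i, absorbing J (t i)) /\
    forall L, elusive (WW n) L -> exists i, forall p, ~ L `<=` closure (t i p).
  apply: (absorbing_exhaustion Xco breg Jsol) => [W []//|K Kco JK [_ eK]].
  have [|W [oW KW WU]] := vietoris_upper hX Xco (oU n) Jsub _ Kco JK.
    by move=> L JL; have : (\bigcap_i U i) L; [rewrite -JU | apply].
  exact: (eK W).
have [t tP] := choice WWt.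
pose dec i : nat * nat := odflt (0%N, 0%N) (unpickle i).
exists (fun i => t (dec i).1 (dec i).2); split=> [i|L Lco nJL].
  exact: (tP _).1.
pose LL : hyperspace X := SigSub (mem_set Lco : L \in [set K : set X | compact K]).
have /existsNP [n /not_implyP [_ nUL]] : ~ (\bigcap_i U i) LL by rewrite -JU.
have eL : elusive (WW n) L.
  by split=> // W [oW WU] LW; apply: nUL; exact: WU.
have [i tL] := (tP n).2 L eL.
by exists (pickle (n, i)); rewrite /dec pickleK.
Qed.

(** * Representation of the ideal by dense open sets of a countable preorder *)

(** As in forcing, [le q p] means that [q] refines [p]. *)
Definition dense_open (le : nat -> nat -> Prop) (D : set nat) : Prop :=
  (forall p q, le q p -> D p -> D q) /\ forall p, exists2 q, le q p & D q.

Lemma sigma_star_bigcup (X : topologicalType) (I : set (set X))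
    (C : nat -> set X) :
  sigma_star_ideal I -> (forall n, I (C n)) -> I (\bigcup_n C n).
Proof.
move=> [_ [J [_ ->]]] IC; have [F FP] := choice IC.
exists (\bigcup_n F n); split.
- by apply: bigcup_countable => // n _; have [] := FP n.
- by move=> A [n _ FA]; have [_ + _] := FP n; apply.
- move=> x [n _ Cx]; have [_ _ /(_ x Cx) [B FB Bx]] := FP n.
  by exists B => //; exists n.
Qed.

Lemma sigma_star_representation (X : topologicalType) (b : nat -> set X)
    (I : set (set X)) :
  hausdorff_space X -> compact [set: X] -> regular_base b ->
  sigma_star_ideal I ->
  exists le : nat -> nat -> Prop,
    [/\ forall p, le p p, forall p q r, le p q -> le q r -> le p r &
    exists D : set X -> set nat, (forall A, I A -> dense_open le (D A)) /\
      forall E, dense_open le E ->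
      exists2 C, I C & forall A, I A -> E `<=` D A -> A `<=` C].
Proof.
move=> hX Xco breg [_ [J [Jstar IE]]].
have [t tP] := choice (fun n =>
  Gdelta_ideal_absorbing hX Xco breg (Jstar n).1 (Jstar n).2).
(* A number [l] codes an ideal index n and a label of a compact set; a condition [m] codes (l, (i,
   p)), and [V m] is the p-th set of the i-th absorbing sequence for [J n]. *)
pose dec2 l : nat * nat := odflt (0%N, 0%N) (unpickle l).
have dec2K u : dec2 (pickle u) = u by rewrite /dec2 pickleK.
pose dec3 m : nat * (nat * nat) := odflt (0%N, (0%N, 0%N)) (unpickle m).
have dec3K u : dec3 (pickle u) = u by rewrite /dec3 pickleK.
pose V m := t (dec2 (dec3 m).1).1 (dec3 m).2.1 (dec3 m).2.2.
pose le q p := [/\ (dec3 q).1 = (dec3 p).1, (dec3 q).2.1 = (dec3 p).2.1 &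
  V p `<=` V q].
have J0 n : J n set0.
  have [[[[A JA] Jsub _] _] _] := Jstar n; exact: Jsub JA.
have kap A : exists K : nat -> set X, I A ->
    (forall l, compact (K l) /\ J (dec2 l).1 (K l)) /\ A `<=` \bigcup_l K l.
  have [|nIA] := pselect (I A); last by exists (fun _ => set0).
  rewrite {1}IE => -[F [/countable_injP [f finj] FJ AF]].
  pose P l B := [/\ F B, compact B, J (dec2 l).1 B & f B = (dec2 l).2].
  (* The member of [F] labelled by the second part of [l], if it belongs to the ideal named by the
     first part; otherwise the empty set. *)
  exists (fun l => xget set0 (P l)) => _; split.
    move=> l; case: xgetP => [B _ []//|_].
    by split; [exact: compact0 | exact: J0].
  move=> x /AF [B FB Bx]; have [n _ [JB Bco]] := FJ B FB.
  exists (pickle (n, f B)) => //; case: xgetP => [C _ [FC _ _]|noP].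
    by rewrite dec2K /= => /finj -> //; rewrite inE.
  by case: (noP B); split=> //; rewrite dec2K.
have [K KP] := choice kap.
exists le; split=> [p|p q r [e1 e2 s1] [e3 e4 s2]|].
- by split.
- by split; [rewrite e1|rewrite e2|exact: subset_trans s1].
exists (fun A m => K A (dec3 m).1 `<=` V m); split.
  move=> A IA; have [KJ AK] := KP A IA; split.
    by move=> p q [-> _ s] Kp; exact: subset_trans s.
  move=> p; have [Kco JK] := KJ (dec3 p).1.
  have [q pq] := (tP _).1 (dec3 p).2.1 _ Kco JK (dec3 p).2.2.
  exists (pickle ((dec3 p).1, ((dec3 p).2.1, q))).
    split; rewrite /V !dec3K //=.
    by apply: subset_trans pq; exact: subsetUl.
  by rewrite /V !dec3K /=; apply: subset_trans pq; exact: subsetUr.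
move=> E [_ Edense].
pose C l := \bigcap_(m in [set m | E m /\ (dec3 m).1 = l]) closure (V m).
have Cco l : compact (C l).
  apply: (subclosed_compact _ Xco) => //.
  by apply: closed_bigI => m _; exact: closed_closure.
(* If [C l] were not in the ideal, some sequence i would never cover it by a closure. But [E]
   contains a refinement of (l, (i, 0)), which keeps l and i. *)
have JC l : J (dec2 l).1 (C l).
  apply: contrapT => nJ; have [i iP] := (tP _).2 (C l) (Cco l) nJ.
  have [m [e1 e2 _] Em] := Edense (pickle (l, (i, 0%N))).
  rewrite !dec3K /= in e1 e2.
  apply: (iP (dec3 m).2.2) => x Cx; rewrite -e1 -e2.
  exact: (Cx m).
exists (\bigcup_l C l).
  rewrite IE; exists (range C); split=> //.
  - exact: card_image_le.
  - by move=> _ [l _ <-]; exists (dec2 l).1.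
  - by move=> x [l _ Cx]; exists (C l) => //; exists l.
move=> A IA EA x Ax; have [l _ Kx] := (KP A IA).2 x Ax; exists l => // m [Em ml].
by apply: subset_closure; apply: (EA m Em); rewrite ml.
Qed.

(** * Words coding finite partial functions *)

Lemma prefix_size (T : eqType) (a b t : seq T) :
  prefix a t -> prefix b t -> (size a <= size b)%N -> prefix a b.
Proof.
rewrite !prefixE => /eqP a_t /eqP b_t ab.
by rewrite -b_t take_takel // a_t.
Qed.

Section words.
Variable le : nat -> nat -> Prop.
Hypotheses (lexx : forall p, le p p)
  (le_trans : forall p q r, le p q -> le q r -> le p r).

(* A word over bool is cut into blocks 0^n 1, and the block 0^n 1 stands for the
   n-th finite sequence r, read as the partial function p |-> nth 0 r p. Empty
   blocks (n = 0) are idle, so that padding a word by [true] changes nothing.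
   [run w p] is the pair of the length of the current unfinished block and of the
   image of p under the partial functions coded by the finished ones. *)
Definition unblock (n : nat) : seq nat :=
  if n is k.+1 then odflt [::] (unpickle k) else [::].

Lemma unblockK (r : seq nat) : unblock (pickle r).+1 = r.
Proof. by rewrite /unblock pickleK. Qed.

(** Values that do not refine [p] are ignored, so running any word only refines the starting
    point. *)
Definition refine_at (r : seq nat) (p : nat) : nat :=
  if (p < size r)%N && `[< le (nth 0 r p) p >] then nth 0 r p else p.

Definition run_step (s : nat * nat) (c : bool) : nat * nat :=
  if c then (0, refine_at (unblock s.1) s.2)%N else (s.1.+1, s.2).

Definition run (w : seq bool) (p : nat) : nat * nat := foldl run_step (0%N, p) w.

(* Appending [true] to [w] closes a block whose partial function maps into D
   every point reached by [w] from a starting point m <= count id w. *)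
Definition good (D : set nat) (w : seq bool) : Prop :=
  let r := unblock (run w 0).1 in
  (forall m, (m <= count id w)%N -> ((run w m).2 < size r)%N) /\
  forall p, (p < size r)%N -> le (nth 0 r p) p /\ D (nth 0 r p).

Lemma refine_at_le r p : le (refine_at r p) p.
Proof. by rewrite /refine_at; case: ifP => [/andP[_ /asboolP]|_]. Qed.

Lemma run_rcons w c p : run (rcons w c) p = run_step (run w p) c.
Proof. by rewrite /run foldl_rcons. Qed.

Lemma run1 w p q : (run w p).1 = (run w q).1.
Proof.
by elim/last_ind: w => // w [] IH; rewrite !run_rcons /run_step /= ?IH.
Qed.

Lemma run_cat_le u v p : le (run (u ++ v) p).2 (run u p).2.
Proof.
elim/last_ind: v => [|v c IH]; first by rewrite cats0.
rewrite -rcons_cat run_rcons; case: c => //=.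
exact: le_trans (refine_at_le _ _) IH.
Qed.

Lemma run_nseq_false u n p :
  run (rcons u true ++ nseq n false) p = (n, (run (rcons u true) p).2).
Proof.
elim: n => [|n IH]; first by rewrite cats0 run_rcons /run_step.
rewrite -[n.+1]addn1 nseqD catA /= cats1 run_rcons IH /run_step /=.
by rewrite addn1.
Qed.

(** At the start and after each [true] the current block is empty; it codes the empty function,
    whose domain misses the point reached from 0. *)
Lemma good_last D w : good D w -> last true w = false.
Proof.
move=> [/(_ 0%N (leq0n _)) + _]; elim/last_ind: w => // w [] _.
  by rewrite run_rcons.
by rewrite last_rcons.
Qed.

Lemma good_run D w m : good D w -> (m <= count id w)%N ->
  D (run (rcons w true) m).2.
Proof.
move=> [lt gD] /lt mw; rewrite run_rcons /run_step /=.
rewrite (run1 w m 0); have [ler Dr] := gD _ mw.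
by rewrite /refine_at mw asboolT.
Qed.

(** Only finitely many starting points matter, so a finite piece of a choice function into [D],
    defined up to the largest point [B] reached, can be coded by one block. *)
Lemma good_extension D u : dense_open le D ->
  exists n, good D (rcons u true ++ nseq n false).
Proof.
move=> [_ Dd]; have {}Dd p : exists q, le q p /\ D q by have [q] := Dd p; exists q.
have [g gP] := choice Dd.
pose c := count id (rcons u true).
pose B := \max_(m < c.+1) (run (rcons u true) m).2.
pose r := mkseq g B.+1.
exists (pickle r).+1.
rewrite /good run_nseq_false unblockK size_mkseq.
rewrite count_cat count_nseq mul0n addn0 -/c; split=> [m mc|p pB].
  rewrite run_nseq_false /= ltnS.
  exact: (leq_bigmax (Ordinal (mc : m < c.+1)%N)).
by rewrite nth_mkseq.
Qed.

Definition clean (D : set nat) (t : seq bool) : Prop :=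
  forall w, good D w -> ~ prefix (rcons w true) t.

(** A good word found in [t] cannot end inside [u], which is clean, nor at the end of [u] or in the
    padding, since it ends in [false]. So it contains the p letters [true] of the padding, hence
    treats the starting point [p]; the rest of [t] only refines. *)
Lemma clean_run D u p t : dense_open le D -> last true u = true -> clean D u ->
  prefix (u ++ nseq p true) t -> ~ clean D t -> D (run t p).2.
Proof.
move=> [Ddown _] lu cu pt /existsNP [w /not_implyP [gw /contrapT pw]].
have lw := good_last gw.
have vw : prefix (u ++ nseq p true) w.
  have [vw|wv] := leqP (size (u ++ nseq p true)) (size w).
    by apply: prefix_size pt (prefix_trans (prefix_rcons _ _) pw) vw.
  have pwv : prefix (rcons w true) (u ++ nseq p true).
    by apply: prefix_size pw pt _; rewrite size_rcons.
  have [wu|uw] := ltnP (size w) (size u).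
    case: (cu w gw); apply: prefix_size pwv (prefix_prefix _ _) _.
    by rewrite size_rcons.
  have /prefixP [s e] := prefix_trans (prefix_rcons w true) pwv.
  suff : last true w = true by rewrite lw.
  have -> : w = u ++ nseq (size w - size u) true.
    have : take (size w) (u ++ nseq p true) = w by rewrite e take_size_cat.
    have wup : (size w - size u <= p)%N.
      by rewrite size_cat size_nseq in wv; lia.
    by rewrite take_cat ltnNge uw /= take_nseq // => {1}<-.
  by rewrite last_cat lu; elim: (_ - _)%N.
have pc : (p <= count id w)%N.
  move: vw => /prefixP [s ->]; rewrite !count_cat count_nseq /= mul1n; lia.
have Dw := good_run gw pc.
by move: pw => /prefixP [s ->]; apply: Ddown Dw; exact: run_cat_le.
Qed.

End words.

(** * Words read along points of a product space *)

Section coding.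
Variables (Z0 : topologicalType) (e : bool -> set Z0).
Hypotheses (e_open : forall c, open (e c)) (e_pt : forall c, e c !=set0).
Hypothesis e_disj : forall c c' x, e c x -> e c' x -> c = c'.
Hypothesis e_dense : forall U, open U -> U !=set0 -> exists c, U `&` e c !=set0.

Let Z : topologicalType := prod_topology (fun _ : nat => Z0).

(** A coordinate may lie outside both sets of [e], as 1/2 does in the unit interval, so points are
    matched against words rather than decoded. *)
Definition codes (x : nat -> bool) : set Z := [set z | forall k, e (x k) (z k)].

Definition cylinder (w : seq bool) : set Z :=
  [set z | forall k, (k < size w)%N -> e (nth true w k) (z k)].

Lemma cylinder_open w : open (cylinder w).
Proof.
elim/last_ind: w => [|w c IH].
  have -> : cylinder [::] = setT by apply/seteqP; split.
  exact: openT.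
have -> : cylinder (rcons w c) = cylinder w `&` (proj (size w) @^-1` e c).
  apply/seteqP; split=> [z wz|z [wz cz] k].
    split; last by have := wz (size w); rewrite size_rcons nth_rcons ltnn eqxx; apply.
    move=> k kw; have := wz k; rewrite size_rcons nth_rcons kw; apply.
    by rewrite ltnS ltnW.
  rewrite size_rcons ltnS leq_eqVlt nth_rcons => /orP[/eqP ->|kw].
    by rewrite ltnn eqxx.
  by rewrite kw; exact: wz.
apply: openI => //; apply: open_comp => // z _.
exact: (@proj_continuous nat (fun=> Z0) (size w) z).
Qed.

Lemma product_box (U : set Z) (z : Z) : open U -> U z ->
  exists n (O : nat -> set Z0), (forall k, open (O k) /\ O k (z k)) /\
    forall z' : Z, (forall k, (k < n)%N -> O k (z' k)) -> U z'.
Proof.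
move=> oU Uz.
pose F := filter_from
  [set nO : nat * (nat -> set Z0) | forall k, open (nO.2 k) /\ nO.2 k (z k)]
  (fun nO => [set z' : Z | forall k, (k < nO.1)%N -> nO.2 k (z' k)]).
have FF : Filter F.
  apply: filter_from_filter.
    by exists (0%N, fun=> setT) => k; split=> //; exact: openT.
  move=> [n O] [n' O'] /= On On'; exists (maxn n n', fun k => O k `&` O' k).
    move=> k /=; have [oO Oz] := On k; have [oO' Oz'] := On' k.
    by split=> //; exact: openI.
  move=> z' /= h; split=> k kn; have [] // := h k.
    exact: leq_trans (leq_maxl _ _).
  exact: leq_trans (leq_maxr _ _).
have cvF : F --> z.
  apply/cvg_sup => i A /= [_ [[ O oO <-] Oz sOA]].
  exists (i.+1, fun k => if k == i then O else setT).
    by move=> k /=; case: eqP => [->|_]; split=> //; exact: openT.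
  by move=> z' /= /(_ i (ltnSn i)); rewrite eqxx => Oz'; exact: sOA.
have [[n O] /= On sU] : F U by apply: cvF; exact: open_nbhs_nbhs.
by exists n, O; split=> // z' /sU.
Qed.

Lemma word_in_open (U : set Z) n : open U -> U !=set0 ->
  exists2 u : seq bool, (n <= size u)%N &
    forall x : nat -> bool, (forall k, (k < size u)%N -> x k = nth true u k) ->
    U `&` codes x !=set0.
Proof.
move=> oU [z Uz]; have [n0 [ O [Oz OU]]] := product_box oU Uz.
pose O' k := if (k < n0)%N then O k else setT.
have O'c k : exists c, O' k `&` e c !=set0.
  apply: e_dense; rewrite /O'; case: ifP => _; try exact: openT.
  - exact: (Oz k).1.
  - by exists (z k); exact: (Oz k).2.
  - by exists (z k).
have [c cP] := choice O'c; have [y yP] := choice cP; have [a aP] := choice e_pt.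
pose N := maxn n n0; exists (mkseq c N).
  by rewrite size_mkseq leq_maxl.
rewrite size_mkseq => x xc.
exists (fun k => if (k < N)%N then y k else a (x k)); split.
  apply: OU => k kn; have kN : (k < N)%N by rewrite leq_max kn orbT.
  by rewrite kN; have [] := yP k; rewrite /O' kn.
move=> k; case: ifP => kN //; rewrite xc // nth_mkseq //.
by have [] := yP k.
Qed.

Lemma cylinder_agree w v z : cylinder w z -> cylinder v z ->
  forall k, (k < size w)%N -> (k < size v)%N -> nth true w k = nth true v k.
Proof. by move=> wz vz k kw kv; exact: e_disj (wz k kw) (vz k kv). Qed.

Lemma cylinder_prefix w v z : cylinder w z -> cylinder v z ->
  (size w <= size v)%N -> prefix w v.
Proof.
move=> wz vz wv; rewrite prefixE; apply/eqP; apply: (@eq_from_nth _ true).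
  by rewrite size_takel.
rewrite size_takel // => k kw; rewrite nth_take //.
by apply: cylinder_agree vz wz _ _ _ => //; exact: leq_trans wv.
Qed.

Lemma codes_cylinder t j z : codes (nth true t) z -> cylinder (t ++ nseq j true) z.
Proof.
move=> tz k _; have := tz k; rewrite nth_cat nth_nseq.
by case: (ltnP k (size t)) => // kt; rewrite nth_default // if_same.
Qed.

Variable le : nat -> nat -> Prop.
Hypotheses (lexx : forall p, le p p)
  (le_trans : forall p q r, le p q -> le q r -> le p r).

Definition avoider (D : set nat) : set Z :=
  [set z | forall w, good le D w -> ~ cylinder (rcons w true) z].

(** The set is closed, and any open set contains a point coded by a word that [good_extension] has
    made good, followed by [true]. *)
Lemma avoider_nwd D : dense_open le D -> nowhere_dense Z (avoider D).
Proof.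
move=> Ddo; have cl : closed (avoider D).
  have -> : avoider D = ~` \bigcup_(w in good le D) cylinder (rcons w true).
    by apply/seteqP; split=> z hz; [move=> [w gw /(hz w gw)] | move=> w gw wz; apply: hz; exists w].
  by apply: open_closedC; apply: bigcup_open => w _; exact: cylinder_open.
rewrite /nowhere_dense /= -(closure_id _).1 //; apply/seteqP; split=> // z zi.
have [|u _ uP] := @word_in_open _ 0 (@open_interior _ (avoider D)).
  by exists z.
have [n gn] := good_extension u Ddo.
set w := _ ++ _ in gn.
have [|z' [/interior_subset az' cz']] := uP (nth true (rcons w true)).
  move=> k ku; rewrite nth_rcons size_cat size_rcons.
  have -> : (k < (size u).+1 + size (nseq n false))%N by lia.
  by rewrite nth_cat size_rcons ltnS ltnW // nth_rcons ku.
by apply: (az' w gn) => k _; exact: cz'.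
Qed.

Lemma avoid_nwd (N U : set Z) v : nowhere_dense Z N -> open U ->
  U `&` cylinder v !=set0 ->
  exists t z, [/\ prefix v t, (size v < size t)%N, last true t = true,
    (U `&` ~` closure N) z & codes (nth true t) z].
Proof.
move=> nN oU [z0 Uz0].
pose O := (U `&` cylinder v) `&` ~` closure N.
have oO : open O.
  apply: openI; first by apply: openI => //; exact: cylinder_open.
  by apply: closed_openC; exact: closed_closure.
have O0 : O !=set0.
  apply: contrapT => nO; have : interior (closure N) z0.
    apply: (@filterS _ _ _ (U `&` cylinder v)).
      by move=> y Uy; apply: contrapT => ny; apply: nO; exists y.
    by apply: open_nbhs_nbhs; split=> //; apply: openI => //; exact: cylinder_open.
  by rewrite nN.
have [u uv uP] := word_in_open (size v) oO O0.
have [|z [[[Uz vz] nz] cz]] := uP (nth true (rcons u true)).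
  by move=> k ku; rewrite nth_rcons ku.
exists (rcons u true), z; split=> //.
- apply: cylinder_prefix vz _ _; last by rewrite size_rcons ltnW.
  by move=> k _; exact: cz.
- by rewrite size_rcons.
- by rewrite last_rcons.
Qed.

(** The point codes [t] followed by [true] forever. A good word ends in [false], so along [z] it
    must end before the last letter of [t]. *)
Lemma not_clean D t z : dense_open le D -> last true t = true ->
  codes (nth true t) z -> ~ avoider D z -> ~ clean le D t.
Proof.
move=> Ddo lt tz /existsNP [w /not_implyP [gw /contrapT wz]] /(_ w gw); apply.
have [tw|wt] := leqP (size t) (size w); last first.
  have tz0 : cylinder t z by move=> k _; exact: tz.
  by apply: cylinder_prefix wz tz0 _; rewrite size_rcons.
suff lw : last true w = true by have := good_last gw; rewrite lw.
case: w => [//|c w] in wz tw {gw} *; set k := size w.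
have kw : (k < size (c :: w))%N by [].
suff -> : last true (c :: w) = nth true t k.
  have [tk|kt] := leqP (size t) k; first by rewrite nth_default.
  have -> : k = (size t).-1 by rewrite /= in tw; lia.
  by rewrite nth_last lt.
rewrite -nth_last -/k; have := e_disj (wz k _) (tz k).
by rewrite size_rcons nth_rcons kw; apply; exact: ltnW.
Qed.

Definition run_set (t : nat -> seq bool) : set nat :=
  [set q | exists p, le q (run le (t p) p).2].

Lemma run_set_dense_open t : dense_open le (run_set t).
Proof.
split=> [p q qp [r pr]|p]; first by exists r; exact: le_trans pr.
exists (run le (t p) p).2; first exact: (run_cat_le lexx le_trans [::] (t p) p).
by exists p.
Qed.

Lemma run_set_sub D u t : dense_open le D -> last true u = true -> clean le D u ->
  (forall p, prefix (u ++ nseq p true) (t p)) ->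
  (forall p, ~ clean le D (t p)) -> run_set t `<=` D.
Proof.
move=> Ddo lu cu ut nct q [p qp]; apply: Ddo.1 qp _.
exact: (clean_run lexx le_trans Ddo lu cu (ut p) (nct p)).
Qed.

Lemma clean_nil D : clean le D [::].
Proof. by case. Qed.

(** For each p, take a word starting with p letters [true] and coded, with padding, by a point
    outside [N]. That point is not in [avoider D], so the word is not clean and its run from p
    enters [D]. *)
Lemma avoider_bounded_nwd N : nowhere_dense Z N ->
  exists2 E, dense_open le E &
    forall D, dense_open le D -> avoider D `<=` N -> E `<=` D.
Proof.
move=> nN; have [a aP] := choice e_pt.
have tex p : exists t : seq bool, prefix (nseq p true) t /\
    exists z, [/\ last true t = true, ~ N z & codes (nth true t) z].
  have [|t [z [pt _ lt [_ nz] cz]]] := avoid_nwd (v := nseq p true) nN openT.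
    exists (fun _ => a true); split=> // k _.
    by rewrite nth_nseq if_same.
  by exists t; split=> //; exists z; split=> // /subset_closure.
have [t tP] := choice tex.
exists (run_set t); first exact: run_set_dense_open.
move=> D Ddo DN; apply: (run_set_sub Ddo _ (@clean_nil D)) => // p.
  exact: (tP p).1.
have [_ [z [lt nz cz]]] := tP p.
by apply: (not_clean Ddo lt cz) => /DN.
Qed.

(* The nodes of the tree carry a word and an open set inside its cylinder. *)
Lemma avoider_bounded_meager (N : nat -> set Z) :
  hausdorff_space Z0 -> compact [set: Z0] ->
  (forall j, nowhere_dense Z (N j)) ->
  exists E : seq nat -> set nat, (forall s, dense_open le (E s)) /\
    forall D, dense_open le D -> avoider D `<=` \bigcup_j N j ->
      exists s, E s `<=` D.
Proof.
move=> hZ0 Z0co nN; have [a aP] := choice e_pt.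
have hZ : hausdorff_space Z by exact: (@hausdorff_product _ (fun _ : nat => Z0)).
have Zco : compact [set: Z].
  have := @tychonoff nat (fun=> Z0) (fun=> setT) (fun=> Z0co).
  by congr compact; apply/seteqP; split.
(* The open set meets every padded cylinder, so a child can be built for each p with a word that
   starts with the padding of length p. *)
pose node (tB : seq bool * set Z) := [/\ last true tB.1 = true, open tB.2 &
  forall p, tB.2 `&` cylinder (tB.1 ++ nseq p true) !=set0].
have step (x : (nat * nat) * (seq bool * set Z)) :
    exists tB : seq bool * set Z, node x.2 ->
      [/\ node tB, prefix (x.2.1 ++ nseq x.1.2 true) tB.1,
        (size x.2.1 < size tB.1)%N &
        closure tB.2 `<=` x.2.2 `&` cylinder tB.1 `&` ~` N x.1.1].
  case: x => [[j p] [t B]] /=.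
  have [[/= lt oB Bt]|] := pselect (node (t, B)); last by exists ([::], set0).
  have [t' [z [tt' stt' lt' [Bz nz] cz]]] := avoid_nwd (nN j) oB (Bt p).
  pose O := B `&` cylinder t' `&` ~` closure (N j).
  have Oz : nbhs z O.
    apply: open_nbhs_nbhs; split.
      apply: openI; first by apply: openI => //; exact: cylinder_open.
      by apply: closed_openC; exact: closed_closure.
    by split; [split=> // k _; exact: cz|exact: nz].
  have [V Vz VO] := compact_regular hZ Zco (@filterT _ (nbhs z) _) Oz.
  exists (t', interior V) => _; split=> //=.
  - split=> [//||q] /=; first exact: open_interior.
    by exists z; split=> //; exact: codes_cylinder.
  - by apply: leq_ltn_trans stt'; rewrite size_cat leq_addr.
  - move=> y yV; have [|[By ty] nNy] := VO y.
      by apply: closure_subset yV; exact: interior_subset.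
    by split=> // /subset_closure.
have [g gP] := choice step.
pose st := fix st (s : seq nat) : seq bool * set Z :=
  if s is p :: s' then g ((size s', p), st s') else ([::], setT).
have stnode s : node (st s).
  elim: s => [|p s IH]; last by have [] := gP ((size s, p), st s) IH.
  split=> //; first exact: openT.
  move=> p; exists (fun _ => a true); split=> // k _.
  by rewrite nth_nseq if_same.
have stP p s := gP ((size s, p), st s) (stnode s).
exists (fun s => run_set (fun p => (st (p :: s)).1)); split=> [s|D Ddo DN].
  exact: run_set_dense_open.
apply: contrapT => nE.
(* If all children of a clean node were unclean, [run_set_sub] would put [E s] inside [D]. *)
have next s : exists p, clean le D (st s).1 -> clean le D (st (p :: s)).1.
  have [cs|] := pselect (clean le D (st s).1); last by exists 0%N.
  apply: contrapT => nc; apply: nE; exists s.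
  have [ls _ _] := stnode s.
  apply: (run_set_sub Ddo ls cs) => p; first by have [] := stP p s.
  by move=> cp; apply: nc; exists p.
have [h hP] := choice next.
pose br := fix br k : seq nat := if k is k'.+1 then h (br k') :: br k' else [::].
have cbr k : clean le D (st (br k)).1.
  by elim: k => [|k /hP //]; exact: clean_nil.
have szbr k : size (br k) = k by elim: k => //= k ->.
have szst k : (k <= size (st (br k)).1)%N.
  elim: k => // k IH; have [_ _ lt _] := stP (h (br k)) (br k).
  exact: leq_ltn_trans IH lt.
pose C k := closure (st (br k.+1)).2.
have CP k : C k `<=` (st (br k)).2 `&` cylinder (st (br k.+1)).1 `&` ~` N k.
  have -> : N k = N (size (br k)) by rewrite szbr.
  by have [_ _ _ c] := stP (h (br k)) (br k).
(* A common point of the closures along the clean branch avoids every [N j]; it lies in [avoider D]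
   because the words on the branch are clean and arbitrarily long. *)
have [z Cz] : \bigcap_k C k !=set0.
  apply: contrapT => /nonemptyPn C0.
  have [|||k Ck] := @nested_closed_sub _ C set0 Zco _ _ open0.
  - by move=> k; exact: closed_closure.
  - by move=> k x /CP [[Bx _] _]; exact: subset_closure.
  - by rewrite C0.
  have [_ _ /(_ 0%N) [y [By _]]] := stnode (br k.+1).
  by have := Ck y (subset_closure By).
have [j _ Nz] : (\bigcup_j N j) z.
  apply: DN => w gw wz; pose k := size w.
  have [[_ tz] _] := CP k z (Cz k Logic.I).
  apply: (cbr k.+1 w gw); apply: cylinder_prefix wz tz _.
  by rewrite size_rcons; exact: szst.
by have [_ nNz] := CP j z (Cz j Logic.I).
Qed.

End coding.

(** * Cardinal characteristics and Tukey maps *)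

(* A maximal family of choice functions that pairwise differ at every member
   of [P] exhausts some member, which therefore injects into all the others. *)
Lemma exists_min_card (U : Type) (P : set (set U)) : P !=set0 ->
  exists2 F, P F & forall F', P F' -> F #<= F'.
Proof.
move=> [F0 PF0].
have [[F [PF F_0]]|nempty] := pselect (exists F, P F /\ F = set0).
  by exists F => // F' _; rewrite F_0; exact: card_ge0.
have {}nempty F : P F -> F !=set0.
  by move=> PF; apply/set0P/eqP => F_0; apply: nempty; exists F.
have [u0 _] := nempty _ PF0.
pose Q := [set G : set (set U -> U) |
  (forall g F, G g -> P F -> F (g F)) /\
  (forall g g' F, G g -> G g' -> P F -> g F = g' F -> g = g')].
have [|G [[Gin Ginj] Gmax]] := @Zorn_bigcup _ Q.
  move=> S SQ tot; split=> [g F [G SG Gg]|g g' F [G SG Gg] [G' SG' Gg']].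
    by have [+ _] := SQ G SG; apply.
  have [GG'|G'G] := tot G G' SG SG'.
    by have [_ +] := SQ G' SG'; apply=> //; exact: GG'.
  by have [_ +] := SQ G SG; apply=> //; exact: G'G.
(* Otherwise each member of [P] has an element missed by all of [G], and choosing these elements
   gives a new function, against maximality. *)
have [F [PF FG]] : exists F, P F /\ F `<=` [set g F | g in G].
  apply: contrapT => nF.
  have xex F : exists x, P F -> F x /\ forall g, G g -> g F <> x.
    have [PF|] := pselect (P F); last by exists u0.
    apply: contrapT => nx; apply: nF; exists F; split=> // x Fx.
    apply: contrapT => nGx; apply: nx; exists x => _; split=> // g Gg gx.
    by apply: nGx; exists g.
  have [x xP] := choice xex.
  have Gx_proper : G `<` G `|` [set x].
    split; first exact: subsetUl.
    move=> /(_ x (or_intror erefl)) Gx.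
    by have [_ /(_ x Gx)] := xP F0 PF0.
  apply: (Gmax _ Gx_proper).
  split=> [g F [Gg|->] PF|g g' F [Gg|->] [Gg'|->] PF // e].
  - exact: (Gin g F Gg PF).
  - by have [] := xP F PF.
  - exact: (Ginj g g' F).
  - by have [_ /(_ g Gg) []] := xP F PF.
  - by have [_ /(_ g' Gg') []] := xP F PF.
exists F => // F' PF'.
apply: (card_le_trans (subset_card_le FG)).
apply: (card_le_trans (card_image_le _ _)).
have inj : {in G &, injective (fun g => g F')}.
  by move=> g g' /set_mem Gg /set_mem Gg' e; exact: (Ginj g g' F').
have /card_eqPle [_ h] := inj_card_eq inj.
apply: (card_le_trans h); apply: subset_card_le => _ [g Gg <-].
exact: (Gin g F' Gg PF').
Qed.

Section tukey_characteristics.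
Variables (T S : Type) (I : set (set T)) (M : set (set S)).
Variable f : set T -> set S.
Hypotheses (fM : forall A, I A -> M (f A))
  (fbound : forall B, M B -> exists2 C, I C & forall A, I A -> f A `<=` B -> A `<=` C).

Lemma tukey_add :
  (forall A B, A `<=` B -> I B -> I A) ->
  (exists2 F, F `<=` I & ~ I (\bigcup_(A in F) A)) ->
  exists F G, [/\ realizes_add I F, realizes_add M G & G #<= F].
Proof.
move=> Isub [F0 F0I nF0].
have image F : F `<=` I -> ~ I (\bigcup_(A in F) A) ->
    (f @` F) `<=` M /\ ~ M (\bigcup_(B in f @` F) B).
  move=> FI nF; split=> [_ [A FA <-]|]; first exact/fM/FI.
  move=> /fbound [C IC Cbound]; apply: nF; apply: Isub IC => x [A FA Ax].
  apply: (Cbound A (FI A FA) _ x Ax) => y fy.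
  by exists (f A) => //; exists A.
have [|F [FI nF] Fmin] := @exists_min_card (set T)
    [set F | F `<=` I /\ ~ I (\bigcup_(A in F) A)].
  by exists F0.
have [|G GM Gmin] := @exists_min_card (set S)
    [set F | F `<=` M /\ ~ M (\bigcup_(A in F) A)].
  by exists (f @` F); exact: image.
exists F, G; split=> //.
by apply: (card_le_trans (Gmin _ (image F FI nF))); exact: card_image_le.
Qed.

Lemma tukey_cof :
  exists F G, [/\ realizes_cof I F, realizes_cof M G & F #<= G].
Proof.
have bound B : exists C, M B -> I C /\ forall A, I A -> f A `<=` B -> A `<=` C.
  have [/fbound [C IC CB]|nMB] := pselect (M B); first by exists C.
  by exists set0.
have [u uP] := choice bound.
have [|F FP Fmin] := @exists_min_card (set T)
    [set F | F `<=` I /\ forall B, I B -> exists2 A, F A & B `<=` A].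
  by exists I; split=> // B IB; exists B.
have [|G [GM Gcof] Gmin] := @exists_min_card (set S)
    [set F | F `<=` M /\ forall B, M B -> exists2 A, F A & B `<=` A].
  by exists M; split=> // B MB; exists B.
exists F, G; split=> //.
apply: (card_le_trans (Fmin (u @` G) _)); last exact: card_image_le.
split=> [_ [B GB <-]|A IA]; first exact: (uP B (GM B GB)).1.
have [B GB AB] := Gcof (f A) (fM IA).
by exists (u B); [exists B|apply: (uP B (GM B GB)).2].
Qed.

End tukey_characteristics.

(** * The Hilbert cube and the Cantor cube as coding spaces *)

Lemma set_type_hausdorff (X : topologicalType) (A : set X) :
  hausdorff_space X -> hausdorff_space (set_type A).
Proof.
move=> hX p q cl; apply: val_inj; apply: hX => U V Up Vq.
have cv := @initial_continuous (set_type A) X set_val.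
by have [x [Ux Vx]] := cl _ _ (cv p U Up) (cv q V Vq); exists (set_val x).
Qed.

Lemma set_type_compact (X : topologicalType) (A : set X) :
  compact A -> compact [set: set_type A].
Proof.
move=> Aco F FF _.
have FA : (set_val @ F) A.
  have AT : set_val @^-1` A = [set: set_type A].
    by apply/seteqP; split=> // x _; exact: set_valP.
  by change (F (set_val @^-1` A)); rewrite AT; exact: filterT.
have [p [Ap clp]] := Aco (set_val @ F) _ FA.
exists (SigSub (mem_set Ap)); split=> // S B FS [_ [[V oV <-] Vp sVB]].
have FS' : (set_val @ F) (set_val @` S).
  by change (F (set_val @^-1` (set_val @` S))); apply: filterS FS; exact: preimage_image.
have [_ [[x Sx <-] Vx]] := clp _ _ FS' (open_nbhs_nbhs (conj oV Vp)).
by exists x; split=> //; exact: sVB.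
Qed.

Section unit_interval.
Variable R : realType.
Local Open Scope ring_scope.
Import Order.TTheory GRing.Theory Num.Theory.
Import numFieldTopology.Exports.
Local Notation unit_itv := (set_type (`[0, 1]%classic : set R)).

Definition half_itv (c : bool) : set unit_itv :=
  if c then [set x | 2^-1 < set_val x] else [set x | set_val x < 2^-1].

Lemma half_itv_open c : open (half_itv c).
Proof.
case: c.
  by exists [set x : R | 2^-1 < x] => //; exact: open_gt.
by exists [set x : R | x < 2^-1] => //; exact: open_lt.
Qed.

Lemma half_itv_disj c c' x : half_itv c x -> half_itv c' x -> c = c'.
Proof. by case: c; case: c' => //= h /(lt_trans h); rewrite ltxx. Qed.

Lemma half_itv_nonempty c : half_itv c !=set0.
Proof.
have in0 : (0 : R) \in `[0, 1]%classic by rewrite inE /= in_itv /= lexx ler01.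
have in1 : (1 : R) \in `[0, 1]%classic by rewrite inE /= in_itv /= lexx ler01.
case: c; [exists (SigSub in1)|exists (SigSub in0)]; rewrite /half_itv /= set_valE /=.
  by lra.
by lra.
Qed.

Lemma half_itv_dense (U : set unit_itv) : open U -> U !=set0 ->
  exists c, U `&` half_itv c !=set0.
Proof.
move=> [V oV <-] [x Vx].
have [lt|gt|e] := ltgtP (set_val x) 2^-1.
- by exists false, x.
- by exists true, x.
have : nbhs (2^-1 : R) V by apply: open_nbhs_nbhs; split=> //; rewrite -e.
move=> /nbhs_ballP [r /= r0 rV].
(* The shift to the right of 1/2 is at most r/2, to stay in the ball, and at most 1/2, to stay in
   the interval. *)
pose y : R := 2^-1 + Num.min (r / 2) 2^-1.
have m0 : 0 < Num.min (r / 2) 2^-1 by rewrite lt_min; apply/andP; split; lra.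
have [mr m1] : Num.min (r / 2) 2^-1 <= r / 2 /\ Num.min (r / 2) 2^-1 <= 2^-1.
  by split; rewrite ge_min lexx ?orbT.
have yin : y \in `[0, 1]%classic.
  by rewrite inE /= in_itv /= /y; apply/andP; split; lra.
exists true, (SigSub yin); split; rewrite /= set_valE /= /y; last by lra.
apply: rV; rewrite /ball /= opprD addNKr normrN gtr0_norm //; lra.
Qed.

Lemma avoider_bounded_hilbert (le : nat -> nat -> Prop) :
  (forall p, le p p) -> (forall p q r, le p q -> le q r -> le p r) ->
  exists f : set nat -> set (hilbert_cube R),
    (forall D, dense_open le D -> meager (hilbert_cube R) (f D)) /\
    forall B, meager (hilbert_cube R) B ->
      exists E : seq nat -> set nat, (forall s, dense_open le (E s)) /\
        forall D, dense_open le D -> f D `<=` B -> exists s, E s `<=` D.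
Proof.
move=> lexx le_trans; exists (avoider (half_itv) le); split.
  move=> D Ddo; exists (fun=> avoider (half_itv) le D).
    move=> _; apply: avoider_nwd => //.
    - exact: half_itv_open.
    - exact: half_itv_nonempty.
    - exact: half_itv_dense.
  by move=> z az; exists 0%N.
move=> B [N nN BN].
have [|E [Edo EN]] := avoider_bounded_meager half_itv_open
  half_itv_nonempty half_itv_disj half_itv_dense lexx le_trans
  (set_type_hausdorff (@Rhausdorff R)) _ nN.
  by apply: set_type_compact; exact: segment_compact.
exists E; split=> // D Ddo DB; apply: EN => //.
exact: subset_trans BN.
Qed.

End unit_interval.

Lemma avoider_bounded_cantor (le : nat -> nat -> Prop) :
  (forall p, le p p) -> (forall p q r, le p q -> le q r -> le p r) ->
  exists f : set nat -> set cantor_space,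
    (forall D, dense_open le D -> nowhere_dense cantor_space (f D)) /\
    forall N, nowhere_dense cantor_space N -> exists2 E, dense_open le E &
      forall D, dense_open le D -> f D `<=` N -> E `<=` D.
Proof.
move=> lexx le_trans; pose e (c : bool) : set bool := [set c].
have eo c : open (e c) by exact: discrete_open.
have e0 c : e c !=set0 by exists c.
have edisj c c' x : e c x -> e c' x -> c = c' by move=> -> ->.
have edense (U : set bool) : open U -> U !=set0 -> exists c, U `&` e c !=set0.
  by move=> _ [x Ux]; exists x, x.
exists (avoider e le); split.
  by move=> D Ddo; exact: avoider_nwd.
by move=> N nN; exact: avoider_bounded_nwd.
Qed.

Theorem proposition1p10 (R : realType) (X : topologicalType)
    (I : set (set X)) :
  metrizable R X -> compact [set: X] -> sigma_star_ideal I ->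
  tukey_reducible I (nowhere_dense cantor_space) /\
  (\bigcup_(A in I) A = [set: X] -> ~ I [set: X] ->
   (exists F G, [/\ realizes_add I F,
      realizes_add (meager (hilbert_cube R)) G & G #<= F]) /\
   (exists F G, [/\ realizes_cof I F,
      realizes_cof (meager (hilbert_cube R)) G & F #<= G])).
Proof.
move=> Xmet Xco Istar.
have hX := metrizable_hausdorff Xmet.
have [b breg] := metrizable_regular_base Xmet Xco.
have [le [lexx le_trans [D [Ddo Dbound]]]] :=
  sigma_star_representation hX Xco breg Istar.
split.
  have [f [fnwd fbound]] := avoider_bounded_cantor lexx le_trans.
  have Iin (a : I) : I (set_val a) by exact: set_valP.
  have fin (a : I) : f (D (set_val a)) \in nowhere_dense cantor_space.
    by apply/mem_set/fnwd/Ddo.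
  exists (fun a => SigSub (fin a)) => N.
  have [E Edo EN] := fbound _ (set_valP N).
  have [C IC CE] := Dbound E Edo.
  exists (SigSub (mem_set IC)) => a.
  rewrite -!Order.le_val !subsetEset /= => fN.
  exact: (CE _ (Iin a) (EN _ (Ddo _ (Iin a)) fN)).
move=> Icov nIX.
have [f [fM fbound]] := avoider_bounded_hilbert R lexx le_trans.
(* A meager set yields countably many dense open sets [E s], each with a bound in [I]; the union of
   these bounds is in [I] and serves whichever [s] occurs. *)
have bound B : meager (hilbert_cube R) B ->
    exists2 C, I C & forall A, I A -> f (D A) `<=` B -> A `<=` C.
  move=> /fbound [E [Edo EB]].
  have ex s : exists C, I C /\ forall A, I A -> E s `<=` D A -> A `<=` C.
    by have [C IC CE] := Dbound _ (Edo s); exists C.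
  have [C CP] := choice ex.
  exists (\bigcup_n C (odflt [::] (unpickle n))).
    by apply: sigma_star_bigcup => // n; exact: (CP _).1.
  move=> A IA fB; have [s sD] := EB _ (Ddo A IA) fB.
  by move=> x Ax; exists (pickle s) => //; rewrite pickleK; exact: ((CP s).2 A).
have Dmeager A : I A -> meager (hilbert_cube R) (f (D A)).
  by move=> IA; exact/fM/Ddo.
split; last exact: (tukey_cof (f := f \o D)).
apply: (tukey_add (f := f \o D)) => //; first by case: Istar => -[].
by exists I => //; rewrite Icov.
Qed.
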